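(* Let $n,q,t$ be positive integers. Assume $\mathcal{A}$ is a quantum query algorithm which, given phase-oracle access to two functions $S,U:\{0,1\}^n\to\{0,1\}$ and a classical witness $w\in\{0,1\}^q$, makes at most $t$ queries to each oracle, and satisfies: if $(S,U)$ is at least $\frac{59}{100}$-spectrally Forrelated then there is $w\in\{0,1\}^q$ with $\Pr[\mathcal{A}^{(S,U)}(w)\text{ accepts}]\ge 2/3$, and if $(S,U)$ is at most $\frac{57}{100}$-spectrally Forrelated then $\Pr[\mathcal{A}^{(S,U)}(w)\text{ accepts}]\le 1/3$ for all $w\in\{0,1\}^q$. Let $(S,U)$ be at least $\frac{59}{100}$-spectrally Forrelated, and let $v\in\mathbb{N}$ be such that $(\Delta,U)$ is at most $\frac{57}{100}$-spectrally Forrelated for every subset $\Delta\subset S$ with $|\Delta|\le v$. Then there exists a query algorithm $\mathsf{CumulativeSampler}$ (depending only on $\mathcal{A}$ and $v$) that makes $0$ queries to $S$ and $vt$ queries to $U$, and outputs $v$ distinct elements of $S$ with probability at least $2^{-q}\left(\frac{1}{36t^2}\right)^v$.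
   Context: Functions $S,U:\{0,1\}^n\to\{0,1\}$ are identified with the sets $S^{-1}(1),U^{-1}(1)\subseteq\{0,1\}^n$. For sets $S,U\subseteq\{0,1\}^n$ let $\Pi_S=\sum_{x\in S}|x\rangle\langle x|$, and similarly $\Pi_U$. The pair $(S,U)$ is $\alpha$-spectrally Forrelated where $\alpha=\|\Pi_U H^{\otimes n}\Pi_S\|_{\mathrm{op}}^2$ ($H$ the Hadamard gate); ''at least/at most $\alpha$-spectrally Forrelated'' means this quantity is $\ge\alpha$ / $\le\alpha$. Phase-oracle access to $S$ is the unitary $|b,x\rangle|z\rangle\mapsto(-1)^{b\cdot S(x)}|b,x\rangle|z\rangle$. A query algorithm with classical witness $w$ starts in $|w\rangle|0\cdots0\rangle$, alternates arbitrary unitaries with oracle queries, and accepts by measuring its first qubit. *)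

(* Defs.v *)
From HB Require Import structures.
From mathcomp Require Import all_boot all_order all_algebra.
From mathcomp Require Import complex.
From mathcomp Require Import classical_sets reals.
From Stdlib Require List.
Set Implicit Arguments. Unset Strict Implicit. Unset Printing Implicit Defensive.
Import Order.TTheory GRing.Theory Num.Theory.
Local Open Scope ring_scope.

Definition Bits (k : nat) := {ffun 'I_k -> bool}.

Definition bitn (k : nat) (s : Bits k) (j : nat) : bool :=
  match (insub j : option 'I_k) with Some i => s i | None => false end.

Section Quantum.
Variable R : realType.
Local Notation C := (complex R).

Definition sqmod (z : C) : R := let: Complex a b := z in a ^+ 2 + b ^+ 2.

Definition Vec (k : nat) := Bits k -> C.
Definition Op (k : nat) := Bits k -> Bits k -> C.

Definition vnorm2 (k : nat) (v : Vec k) : R := \sum_x sqmod (v x).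

Definition apply (k : nat) (A : Op k) (v : Vec k) : Vec k :=
  fun x => \sum_y A x y * v y.

Definition unitary (k : nat) (A : Op k) : Prop :=
  forall x y : Bits k, \sum_z (A z x)^* * A z y = (x == y)%:R.

Definition ket (k : nat) (s : Bits k) : Vec k := fun x => (x == s)%:R.

Definition hgate (a b : bool) : C :=
  (if a && b then -1 else 1) * Complex (Num.sqrt (2 : R))^-1 0.

Definition hadamardn (n : nat) : Op n :=
  fun x y => \prod_(i < n) hgate (x i) (y i).

Definition proj (n : nat) (P : {set Bits n}) (v : Vec n) : Vec n :=
  fun x => if x \in P then v x else 0.

Definition opnorm2 (n : nat) (M : Vec n -> Vec n) : R :=
  sup [set r : R | exists v : Vec n, vnorm2 v = 1 /\ r = vnorm2 (M v)].

Definition spec_forr (n : nat) (S U : {set Bits n}) : R :=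
  opnorm2 (fun v => proj U (apply (@hadamardn n) (proj S v))).

Inductive oracle_tag := OS | OU.
Definition isOS (o : oracle_tag) : bool := if o is OS then true else false.
Definition isOU (o : oracle_tag) : bool := if o is OU then true else false.

(* An algorithm on m qubits: an initial unitary U_0, followed by a sequence of
   (query, unitary) steps: state = U_r O_{c_r} ... U_1 O_{c_1} U_0 |init>. *)
Record qalg := QAlg {
  qa_m : nat;
  qa_init : Op qa_m;
  qa_steps : seq (oracle_tag * Op qa_m) }.
Arguments qa_m : clear implicits.
Arguments qa_init : clear implicits.
Arguments qa_steps : clear implicits.

Definition qa_unitary (A : qalg) : Prop :=
  unitary (qa_init A) /\ forall (o : oracle_tag) (W : Op (qa_m A)), List.In (o, W) (qa_steps A) -> unitary W.

Definition nqueries_S (A : qalg) : nat := count (fun p => isOS p.1) (qa_steps A).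
Definition nqueries_U (A : qalg) : nat := count (fun p => isOU p.1) (qa_steps A).

(* The x register of a basis state |b, x, z>: qubits 1..n (b is qubit 0). *)
Definition xreg (n m : nat) (s : Bits m) : Bits n := [ffun i : 'I_n => bitn s i.+1].

Definition phase_oracle (n m : nat) (f : {set Bits n}) (v : Vec m) : Vec m :=
  fun s => if bitn s 0 && (@xreg n m s \in f) then - v s else v s.

Definition run (n : nat) (A : qalg) (S U : {set Bits n}) (psi0 : Vec (qa_m A))
  : Vec (qa_m A) :=
  foldl (fun v p => apply p.2 (phase_oracle (if p.1 is OS then S else U) v))
        (apply (qa_init A) psi0) (qa_steps A).
Arguments run {n} A S U psi0 _.

(* initial state |w>|0...0> : the witness occupies the first q qubits *)
Definition init_state (q m : nat) (w : Bits q) : Vec m :=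
  ket [ffun i : 'I_m => bitn w i].

Definition acc_prob (n q : nat) (A : qalg) (S U : {set Bits n}) (w : Bits q) : R :=
  \sum_(s : Bits (qa_m A) | bitn s 0) sqmod (run A S U (@init_state q (qa_m A) w) s).

Definition sample_prob (n v : nat) (B : qalg) (out : Bits (qa_m B) -> v.-tuple (Bits n))
  (S U : {set Bits n}) : R :=
  \sum_(s : Bits (qa_m B) | uniq (out s) && all (fun x => x \in S) (out s))
     sqmod (run B S U (@ket (qa_m B) [ffun=> false]) s).

End Quantum.

Arguments spec_forr R {n} S U.
Arguments acc_prob {R n q} A S U w.
Arguments sample_prob {R n v B} out S U.

(* Main.v *)
(** Run [A] on a uniformly random witness [w], with the oracle for [S] replaced by
    the set [D] of elements of [S] found so far, and measure the query register
    just before a uniformly random query to [S].  For a good [w] the acceptance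
    probabilities under [S] and [D] differ by 1/3, so by the hybrid argument
    1/3 <= sum_j 2 sqrt(p_j), where [p_j] is the probability that the [j]-th query
    of the run with [D] lies in [S :\: D]; by Cauchy-Schwarz the average of the
    [p_j] is at least 1/(36 t^2).  After [v] rounds these probabilities multiply.
    Random choices are uniform superpositions, queries to the known set [D] are
    plain unitaries, and intermediate measurements become controlled operations
    on fresh qubits; superfluous queries change phases only. *)

Require Import Defs.
From HB Require Import structures.
From mathcomp Require Import all_boot all_order all_algebra.
From mathcomp Require Import complex.
From mathcomp Require Import classical_sets reals.
From mathcomp Require Import perm boolp ring lra.
Import Order.TTheory GRing.Theory Num.Theory.
Local Open Scope ring_scope.

Set Implicit Arguments.
Unset Strict Implicit.
Unset Printing Implicit Defensive.

(** * Squared moduli, conjugation and Kronecker deltas *)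

Lemma sqmod_ge0 (R : realType) (z : complex R) : 0 <= sqmod z.
Proof. by case: z => a b /=; rewrite addr_ge0 ?sqr_ge0. Qed.

Lemma sqmodM (R : realType) (y z : complex R) : sqmod (y * z) = sqmod y * sqmod z.
Proof. case: y z => a b [c d] /=; ring. Qed.

Lemma sqmodN (R : realType) (z : complex R) : sqmod (- z) = sqmod z.
Proof. case: z => a b /=; ring. Qed.

Lemma sqmod0 (R : realType) : sqmod (0 : complex R) = 0.
Proof. by rewrite /= expr0n addr0. Qed.

Lemma sqmod_real (R : realType) (a : R) : sqmod (a%:C)%C = a ^+ 2.
Proof. by rewrite /= expr0n addr0. Qed.

Lemma sqmod_delta (R : realType) (b : bool) : sqmod (b%:R : complex R) = b%:R.
Proof. by case: b => /=; rewrite ?expr0n ?expr1n ?addr0. Qed.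

Lemma conjM_sqmod (R : realType) (z : complex R) : z^* * z = ((sqmod z)%:C)%C.
Proof.
case: z => a b; apply/eqP; rewrite eq_complex /=; apply/andP; split; apply/eqP; ring.
Qed.

Lemma conj_real (R : realType) (r : R) : (r%:C%C)^* = r%:C%C.
Proof. by apply/eqP; rewrite eq_complex /= oppr0 !eqxx. Qed.

Lemma conj_delta (R : realType) (b : bool) : (b%:R : complex R)^* = b%:R.
Proof. by case: b; [exact: conjC1 | exact: conjC0]. Qed.

Lemma conj_mul_delta (R : realType) (z : complex R) (b : bool) :
  (z * b%:R)^* = z^* * b%:R.
Proof. by rewrite rmorphM; congr (_ * _); exact: conj_delta. Qed.

Lemma sum_mul_delta (K : comNzRingType) (I : finType) (a : I) (f : I -> K) :
  \sum_i f i * (i == a)%:R = f a.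
Proof.
rewrite (bigD1 a) //= eqxx mulr1 big1 ?addr0 // => i /negPf ->.
by rewrite mulr0.
Qed.

(** * Operators on qubit registers and elementary unitaries *)

Lemma apply_ket (R : realType) k (A : Op R k) (s : Bits k) :
  apply A (ket R s) = fun x => A x s.
Proof. by apply/funext => x; exact: sum_mul_delta. Qed.

Definition comp_op (R : realType) k (A B : Op R k) : Op R k :=
  fun x y => \sum_z A x z * B z y.

Lemma apply_comp (R : realType) k (A B : Op R k) v :
  apply (comp_op A B) v = apply A (apply B v).
Proof.
apply/funext => x; rewrite /apply /comp_op.
under eq_bigr do rewrite mulr_suml.
rewrite exchange_big; apply: eq_bigr => z _.
by rewrite mulr_sumr; apply: eq_bigr => y _; rewrite mulrA.
Qed.

Lemma unitary_dot (R : realType) k (A : Op R k) (u v : Vec R k) : unitary A ->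
  \sum_x (apply A u x)^* * apply A v x = \sum_x (u x)^* * v x.
Proof.
move=> uA.
transitivity (\sum_y \sum_z (u y)^* * v z * \sum_x (A x y)^* * A x z).
  under [RHS]eq_bigr do under eq_bigr do rewrite mulr_sumr.
  under [RHS]eq_bigr do rewrite exchange_big.
  rewrite [RHS]exchange_big; apply: eq_bigr => x _.
  rewrite /apply rmorph_sum mulr_suml; apply: eq_bigr => y _.
  by rewrite mulr_sumr; apply: eq_bigr => z _; rewrite rmorphM /=; ring.
apply: eq_bigr => y _.
under eq_bigr do rewrite uA eq_sym.
by rewrite sum_mul_delta.
Qed.

(** The columns of [comp_op A B] are the images under [A] of the columns of [B], and [A] preserves
    inner products. *)
Lemma unitary_comp (R : realType) k (A B : Op R k) :
  unitary A -> unitary B -> unitary (comp_op A B).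
Proof.
move=> uA uB x y; rewrite -uB.
rewrite -(unitary_dot (fun z => B z x) (fun z => B z y) uA); exact: eq_bigr.
Qed.

Lemma vnorm2_apply (R : realType) k (A : Op R k) (v : Vec R k) :
  unitary A -> vnorm2 (apply A v) = vnorm2 v.
Proof.
move=> uA; apply: (fmorph_inj (real_complex R)).
rewrite !rmorph_sum /=.
under eq_bigr do rewrite -conjM_sqmod.
under [RHS]eq_bigr do rewrite -conjM_sqmod.
exact: unitary_dot.
Qed.

Lemma vnorm2_ket (R : realType) k (s : Bits k) : vnorm2 (ket R s) = 1.
Proof.
rewrite /vnorm2 (bigD1 s) //= big1 => [|x /negPf xs]; rewrite /ket ?eqxx.
  by rewrite addr0 (sqmod_delta R true).
by rewrite xs sqmod0.
Qed.

Definition diag_op (R : realType) k (d : Vec R k) : Op R k :=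
  fun x y => d x * (y == x)%:R.

Lemma apply_diag (R : realType) k (d v : Vec R k) :
  apply (diag_op d) v = fun x => d x * v x.
Proof.
apply/funext => x; rewrite /apply /diag_op.
under eq_bigr do rewrite mulrAC.
exact: sum_mul_delta.
Qed.

Lemma unitary_diag (R : realType) k (d : Vec R k) :
  (forall x, sqmod (d x) = 1) -> unitary (diag_op d).
Proof.
move=> d1 x y; rewrite /diag_op (bigD1 x) //= big1 ?addr0 => [|z /negPf zx]; last first.
  rewrite [x == z]eq_sym zx.
  by rewrite conj_mul_delta mulr0 mul0r.
by rewrite eqxx mulr1 mulrA conjM_sqmod d1 eq_sym mul1r.
Qed.

(** Acts by precomposition with [g], so the basis state [g x] is sent to [x]. *)
Definition perm_op (R : realType) k (g : Bits k -> Bits k) : Op R k :=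
  fun x y => (y == g x)%:R.

Lemma apply_perm (R : realType) k g (v : Vec R k) :
  apply (perm_op R g) v = fun x => v (g x).
Proof.
apply/funext => x; rewrite /apply /perm_op.
under eq_bigr do rewrite mulrC.
exact: sum_mul_delta.
Qed.

Lemma unitary_perm (R : realType) k (g : Bits k -> Bits k) :
  bijective g -> unitary (perm_op R g).
Proof.
case=> h gK hK x y; rewrite /perm_op (bigD1 (h x)) //= big1 ?addr0 => [|z zx].
  by rewrite conj_delta hK eqxx mul1r eq_sym.
rewrite conj_delta; case: (x =P g z) zx => [->|_ _]; last by rewrite mul0r.
by rewrite gK eqxx.
Qed.

(** The Householder reflection in the hyperplane orthogonal to [a], for [a] of squared norm 2: this
    normalisation absorbs the usual factor 2. *)
Definition reflect_op (R : realType) k (a : Bits k -> R) : Op R k :=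
  fun x y => ((x == y)%:R - (a x * a y)%:C)%C.

Lemma unitary_reflect (R : realType) k (a : Bits k -> R) :
  \sum_x a x ^+ 2 = 2 -> unitary (reflect_op a).
Proof.
move=> a2 x y.
(* The entries are real, so unitarity is an identity over [R]: as [a] has squared norm 2, the
   quadratic term is [2 * a x * a y] and cancels the two cross terms. *)
pose f (b : bool) (r : R) := b%:R - r.
have E : \sum_z f (z == x) (a z * a x) * f (z == y) (a z * a y) = (x == y)%:R.
  transitivity (\sum_z ((z == y)%:R * (z == x)%:R - a z * a y * (z == x)%:R
     - a z * a x * (z == y)%:R + a x * a y * a z ^+ 2)).
    by apply: eq_bigr => z _; rewrite /f; ring.
  rewrite !big_split /= !sumrN sum_mul_delta -mulr_sumr a2.
  by rewrite (sum_mul_delta x (fun z => a z * a y)) (sum_mul_delta y (fun z => a z * a x)); ring.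
have fE z w : reflect_op a z w = (f (z == w) (a z * a w))%:C%C.
  by rewrite rmorphB rmorph_nat.
rewrite -[RHS](rmorph_nat (real_complex R)) -E rmorph_sum; apply: eq_bigr => z _.
rewrite !fE conj_real; exact/esym/rmorphM.
Qed.

(** * Cauchy-Schwarz, norms and measurement statistics *)

(** Lagrange's identity: twice the difference of the two sides is a double sum of squares. *)
Lemma cauchy_schwarz (R : realType) (I : finType) (x y : I -> R) :
  (\sum_i x i * y i) ^+ 2 <= (\sum_i x i ^+ 2) * (\sum_i y i ^+ 2).
Proof.
set X := \sum_i x i ^+ 2; set Y := \sum_i y i ^+ 2; set P := \sum_i x i * y i.
have : 0 <= \sum_i \sum_j (x i * y j - x j * y i) ^+ 2.
  by apply: sumr_ge0 => i _; apply: sumr_ge0 => j _; exact: sqr_ge0.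
suff -> : \sum_i \sum_j (x i * y j - x j * y i) ^+ 2 = 2 * (X * Y) - 2 * P ^+ 2.
  by lra.
transitivity (\sum_i (x i ^+ 2 * Y - 2 * (x i * y i) * P + y i ^+ 2 * X)).
  apply: eq_bigr => i _; rewrite !mulr_sumr -sumrN -!big_split /=.
  by apply: eq_bigr => j _; ring.
by rewrite !big_split /= sumrN -!mulr_suml -mulr_sumr -/X -/Y -/P; ring.
Qed.

Lemma cauchy_schwarz_sqrt (R : realType) (I : finType) (x y : I -> R) :
  (forall i, 0 <= x i) -> (forall i, 0 <= y i) ->
  \sum_i Num.sqrt (x i) * Num.sqrt (y i)
    <= Num.sqrt (\sum_i x i) * Num.sqrt (\sum_i y i).
Proof.
move=> x0 y0; set P := (X in X <= _).
have P0 : 0 <= P by apply: sumr_ge0 => i _; rewrite mulr_ge0 ?sqrtr_ge0.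
have Xs0 : 0 <= \sum_i x i by apply: sumr_ge0.
rewrite -(ger0_norm P0) -sqrtr_sqr -sqrtrM // ler_wsqrtr //.
apply: le_trans (cauchy_schwarz _ _) _.
under eq_bigr do rewrite sqr_sqrtr //.
by under [X in _ * X <= _]eq_bigr do rewrite sqr_sqrtr //.
Qed.

Definition vnorm (R : realType) k (v : Vec R k) : R := Num.sqrt (vnorm2 v).

Lemma vnorm2_ge0 (R : realType) k (v : Vec R k) : 0 <= vnorm2 v.
Proof. by apply: sumr_ge0 => x _; exact: sqmod_ge0. Qed.

Lemma dot_le_sqrt (R : realType) (a b c d : R) :
  a * c + b * d <= Num.sqrt (a ^+ 2 + b ^+ 2) * Num.sqrt (c ^+ 2 + d ^+ 2).
Proof.
apply: le_trans (ler_norm _) _.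
rewrite -sqrtr_sqr -sqrtrM ?addr_ge0 ?sqr_ge0 // ler_wsqrtr //.
have := sqr_ge0 (a * d - b * c); nra.
Qed.

Lemma sqmodD_le (R : realType) (y z : complex R) :
  sqmod (y + z) <= sqmod y + sqmod z + 2 * (Num.sqrt (sqmod y) * Num.sqrt (sqmod z)).
Proof.
case: y z => a b [c d] /=; have := dot_le_sqrt a b c d; lra.
Qed.

(** As vectors of the real plane, [y - z] and [y + z] have inner product [sqmod y - sqmod z]. *)
Lemma sqmod_diff_le (R : realType) (y z : complex R) :
  `|sqmod y - sqmod z| <= Num.sqrt (sqmod (y - z)) * Num.sqrt (sqmod (y + z)).
Proof.
case: y z => a b [c d] /=; rewrite ler_norml; apply/andP; split.
  have := dot_le_sqrt (- (a - c)) (- (b - d)) (a + c) (b + d).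
  by rewrite !sqrrN; lra.
have := dot_le_sqrt (a - c) (b - d) (a + c) (b + d); lra.
Qed.

Lemma vnormD (R : realType) k (u v : Vec R k) :
  vnorm (fun x => u x + v x) <= vnorm u + vnorm v.
Proof.
have u0 := vnorm2_ge0 u; have v0 := vnorm2_ge0 v.
rewrite -[leRHS]ger0_norm ?addr_ge0 ?sqrtr_ge0 //.
rewrite -sqrtr_sqr; apply: ler_wsqrtr.
rewrite sqrrD !sqr_sqrtr //.
have := cauchy_schwarz_sqrt (fun x => sqmod_ge0 (u x)) (fun x => sqmod_ge0 (v x)).
rewrite -/(vnorm2 u) -/(vnorm2 v) -/(vnorm u) -/(vnorm v) => cs.
have : vnorm2 (fun x => u x + v x) <= vnorm2 u + vnorm2 v
    + 2 * \sum_x Num.sqrt (sqmod (u x)) * Num.sqrt (sqmod (v x)).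
  rewrite mulr_sumr -!big_split /=; apply: ler_sum => x _; exact: sqmodD_le.
by lra.
Qed.

(** The differences [f s] sum to 0, so no event gains more than half of their absolute sum. That sum
    is at most the norm of [u - v] times that of [u + v], and the latter is at most 2; the two
    factors 2 cancel. *)
Lemma event_prob_diff (R : realType) k (u v : Vec R k) (P : pred (Bits k)) :
  vnorm2 u = 1 -> vnorm2 v = 1 ->
  \sum_(s | P s) sqmod (u s) - \sum_(s | P s) sqmod (v s)
    <= vnorm (fun s => u s - v s).
Proof.
move=> u1 v1; pose f s := sqmod (u s) - sqmod (v s).
have f0 : \sum_s f s = 0 by rewrite /f sumrB -/(vnorm2 u) -/(vnorm2 v) u1 v1 subrr.
have split_f : \sum_s `|f s| >= 2 * \sum_(s | P s) f s.
  rewrite [leRHS](bigID P) /=; move: f0; rewrite (bigID P) /= => f0.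
  have : \sum_(s | P s) f s <= \sum_(s | P s) `|f s|.
    by apply: ler_sum => s _; exact: ler_norm.
  have : - \sum_(s | ~~ P s) f s <= \sum_(s | ~~ P s) `|f s|.
    by rewrite -sumrN; apply: ler_sum => s _; rewrite lerNl lerNnormlW.
  by lra.
have le_dot : \sum_s `|f s| <= vnorm (fun s => u s - v s) * vnorm (fun s => u s + v s).
  apply: le_trans (cauchy_schwarz_sqrt _ _); try by move=> s; exact: sqmod_ge0.
  by apply: ler_sum => s _; exact: sqmod_diff_le.
have sum2 : vnorm (fun s => u s + v s) <= 2.
  by apply: le_trans (vnormD _ _) _; rewrite /vnorm u1 v1 sqrtr1.
have d0 : 0 <= vnorm (fun s => u s - v s) by exact: sqrtr_ge0.
have -> : \sum_(s | P s) sqmod (u s) - \sum_(s | P s) sqmod (v s) = \sum_(s | P s) f s.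
  by rewrite sumrB.
have := ler_wpM2l d0 sum2; lra.
Qed.

(** * The hybrid argument *)

(** Probability that measuring the query register of [v] gives an element of [E], whatever the
    control qubit is. *)
Definition hit (R : realType) n m (E : {set Bits n}) (v : Vec R m) : R :=
  \sum_(s | xreg n s \in E) sqmod (v s).

Lemma hit_ge0 (R : realType) n m (E : {set Bits n}) (v : Vec R m) : 0 <= hit E v.
Proof. by apply: sumr_ge0 => s _; exact: sqmod_ge0. Qed.

Lemma sqmod_phase (R : realType) n m (E : {set Bits n}) (v : Vec R m) s :
  sqmod (phase_oracle E v s) = sqmod (v s).
Proof. by rewrite /phase_oracle; case: ifP => _ //; exact: sqmodN. Qed.

Lemma vnorm2_phase (R : realType) n m (E : {set Bits n}) (v : Vec R m) :
  vnorm2 (phase_oracle E v) = vnorm2 v.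
Proof. by apply: eq_bigr => s _; exact: sqmod_phase. Qed.

Lemma phase_oracleB (R : realType) n m (E : {set Bits n}) (u v : Vec R m) :
  phase_oracle E (fun s => u s - v s) = fun s => phase_oracle E u s - phase_oracle E v s.
Proof.
by apply/funext => s; rewrite /phase_oracle; case: ifP => // _; rewrite opprD.
Qed.

Lemma applyB (R : realType) m (W : Op R m) (u v : Vec R m) :
  apply W (fun s => u s - v s) = fun s => apply W u s - apply W v s.
Proof.
by apply/funext => s; rewrite /apply -sumrB; apply: eq_bigr => y _; rewrite mulrBr.
Qed.

(** The two oracles differ only by a sign on basis states querying [S :\: D], where the difference
    is 0 or twice the amplitude up to sign. *)
Lemma vnorm_phase_diff (R : realType) n m (D S : {set Bits n}) (v : Vec R m) :
  D \subset S ->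
  vnorm (fun s => phase_oracle S v s - phase_oracle D v s)
    <= 2 * Num.sqrt (hit (S :\: D) v).
Proof.
move=> DS; have -> : 2 = Num.sqrt 4 :> R.
  by rewrite -[2]ger0_norm // -sqrtr_sqr; congr Num.sqrt; ring.
rewrite -sqrtrM //; apply: ler_wsqrtr.
rewrite /hit mulr_sumr [leRHS]big_mkcond; apply: ler_sum => s _.
rewrite /phase_oracle inE.
have := sqmod_ge0 (v s); case: (v s) => a b.
case: (boolP (xreg n s \in D)) => [/(fintype.subsetP DS) -> _|_] /=.
  by case: ifP => _ /=; nra.
by case: (bitn s 0) => /=; case: (xreg n s \in S) => /=; nra.
Qed.

Definition steps_run (R : realType) n m (S U : {set Bits n})
    (st : seq (oracle_tag * Op R m)) (v : Vec R m) : Vec R m :=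
  foldl (fun v p => apply p.2 (phase_oracle (if p.1 is OS then S else U) v)) v st.

(** The states just before each [OS] step, in order of time. *)
Fixpoint S_query_states (R : realType) n m (S U : {set Bits n})
    (st : seq (oracle_tag * Op R m)) (v : Vec R m) : seq (Vec R m) :=
  if st is p :: st' then
    let vs := S_query_states S U st'
      (apply p.2 (phase_oracle (if p.1 is OS then S else U) v)) in
    if isOS p.1 then v :: vs else vs
  else [::].

Lemma size_S_query_states (R : realType) n m (S U : {set Bits n})
    (st : seq (oracle_tag * Op R m)) v :
  size (S_query_states S U st v) = count (fun p => isOS p.1) st.
Proof. by elim: st v => //= -[[] W] st IH v /=; rewrite IH. Qed.

Lemma vnorm2_steps_run (R : realType) n m (S U : {set Bits n})
    (st : seq (oracle_tag * Op R m)) v :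
  (forall o W, List.In (o, W) st -> unitary W) ->
  vnorm2 (steps_run S U st v) = vnorm2 v.
Proof.
elim: st v => //= -[o W] st IH v uW; rewrite /= IH; last first.
  by move=> o' W' h; apply: uW; right; exact: h.
by rewrite vnorm2_apply ?vnorm2_phase //; apply: uW; left.
Qed.

(** Unitaries and equal oracles keep the distance of the two runs; each [OS] step adds at most the
    discrepancy of the two oracles on the state of the run with [D]. Only that run enters the bound,
    and it can be simulated without access to [S]. *)
Lemma hybrid_bound (R : realType) n m (D S U : {set Bits n})
    (st : seq (oracle_tag * Op R m)) u v :
  D \subset S -> (forall o W, List.In (o, W) st -> unitary W) ->
  vnorm (fun s => steps_run S U st u s - steps_run D U st v s)
    <= vnorm (fun s => u s - v s)
       + \sum_(w <- S_query_states D U st v) 2 * Num.sqrt (hit (S :\: D) w).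
Proof.
move=> DS; elim: st u v => [|[o W] st IH] u v uW; first by rewrite big_nil addr0.
have uW1 : unitary W by apply: uW; left.
have uW' o' W' : List.In (o', W') st -> unitary W'.
  by move=> h; apply: uW; right; exact: h.
have step1 : vnorm (fun s => apply W (phase_oracle (if o is OS then S else U) u) s
                           - apply W (phase_oracle (if o is OS then D else U) v) s)
     <= vnorm (fun s => u s - v s) + if isOS o then 2 * Num.sqrt (hit (S :\: D) v) else 0.
  rewrite -applyB /vnorm vnorm2_apply // -/(vnorm _) -/(vnorm _).
  case: o {uW} => /=.
    (* The intermediate state applies the oracle of [S] to the state of the run with [D]. *)
    have -> : (fun s => phase_oracle S u s - phase_oracle D v s)
      = fun s => phase_oracle S (fun s => u s - v s) s
                 + (phase_oracle S v s - phase_oracle D v s).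
      by apply/funext => s; rewrite phase_oracleB addrA subrK.
    apply: le_trans (vnormD _ _) _; apply: lerD (vnorm_phase_diff _ DS).
    by rewrite /vnorm vnorm2_phase.
  by rewrite -phase_oracleB /vnorm vnorm2_phase addr0.
apply: le_trans (IH _ _ uW') _.
move: step1; case: o {uW} => /= step1; rewrite ?big_cons; lra.
Qed.

(** * States preparable with queries to [U] alone *)

(** Each unitary is chosen before [U], so [psi] is the final state of one circuit with exactly [T]
    queries, run on every [U]. *)
Fixpoint reach (R : realType) n m (T : nat) (psi : {set Bits n} -> Vec R m) : Prop :=
  if T is T'.+1 then
    exists (phi : {set Bits n} -> Vec R m) (W : Op R m),
      [/\ reach T' phi, unitary W & forall U, psi U = apply W (phase_oracle U (phi U))]
  else exists2 W : Op R m, unitary W & forall U, psi U = apply W (ket R [ffun=> false]).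

Definition id_op (R : realType) m : Op R m := perm_op R id.

Lemma unitary_id (R : realType) m : unitary (@id_op R m).
Proof. by apply: unitary_perm; exists id. Qed.

Lemma apply_id (R : realType) m (v : Vec R m) : apply (@id_op R m) v = v.
Proof. exact: apply_perm. Qed.

Lemma reach_init (R : realType) n m :
  reach 0 (fun _ : {set Bits n} => ket R [ffun=> false] : Vec R m).
Proof.
by exists (@id_op R m) => [|U]; [exact: unitary_id | rewrite apply_id].
Qed.

Lemma reach_unitary (R : realType) n m T (psi : {set Bits n} -> Vec R m) W :
  reach T psi -> unitary W -> reach T (fun U => apply W (psi U)).
Proof.
case: T => [[V uV E] uW|T [phi [V [rphi uV E]]] uW].
  exists (comp_op W V) => [|U]; first exact: unitary_comp.
  by rewrite apply_comp E.
exists phi, (comp_op W V); split=> // [|U]; first exact: unitary_comp.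
by rewrite apply_comp E.
Qed.

Lemma reach_query (R : realType) n m T (psi : {set Bits n} -> Vec R m) W :
  reach T psi -> unitary W -> reach T.+1 (fun U => apply W (phase_oracle U (psi U))).
Proof. by move=> rpsi uW; exists psi, W. Qed.

(** An added query followed by the identity changes phases only. This turns an upper bound on the
    number of queries into an exact count. *)
Lemma reach_pad (R : realType) n m T T' (psi : {set Bits n} -> Vec R m) :
  (T <= T')%N -> reach T psi ->
  exists2 phi, reach T' phi & forall U s, sqmod (phi U s) = sqmod (psi U s).
Proof.
move=> /subnK <-; move: (T' - T)%N => d; elim: d => [|d IH] rpsi; first by exists psi.
have [phi rphi E] := IH rpsi.
exists (fun U => apply (@id_op R m) (phase_oracle U (phi U))) => [|U s].
  exact/reach_query/unitary_id.
by rewrite apply_id sqmod_phase.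
Qed.

Lemma reach_qalg (R : realType) n m T (psi : {set Bits n} -> Vec R m) :
  reach T psi ->
  exists (W0 : Op R m) (Ws : seq (Op R m)),
    [/\ unitary W0, forall W, List.In W Ws -> unitary W, size Ws = T &
      forall S U, steps_run S U [seq (OU, W) | W <- Ws] (apply W0 (ket R [ffun=> false]))
                  = psi U].
Proof.
elim: T psi => [|T IH] psi.
  by case=> W uW E; exists W, [::]; split=> // S U; rewrite E.
case=> phi [W [/IH [W0 [Ws [uW0 uWs sW E]]] uW Epsi]].
exists W0, (rcons Ws W); split=> // [V||S U].
- by rewrite -cats1 => /(List.in_app_or _ _ _) [/uWs //|[<-|[]]].
- by rewrite size_rcons sW.
by rewrite map_rcons /steps_run foldl_rcons -/(steps_run _ _ _ _) E Epsi.
Qed.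

(** * Splitting a register and controlled operations *)

Definition lo a M (s : Bits M) : Bits a := [ffun i : 'I_a => bitn s i].
Definition hi a b M (s : Bits M) : Bits b := [ffun i : 'I_b => bitn s (a + i)].
(** The size [M] is tied to [a + b] by hypotheses only, so one register can be split both as [a + b]
    and as [b + a] without casts. *)
Definition join a b M (d : Bits a) (c : Bits b) : Bits M :=
  [ffun i : 'I_M => if (i < a)%N then bitn d i else bitn c (i - a)].

Lemma bitnE k (s : Bits k) (i : 'I_k) : bitn s i = s i.
Proof. by rewrite /bitn valK. Qed.

Lemma bitn_ffun k (f : nat -> bool) j : (j < k)%N ->
  bitn [ffun i : 'I_k => f i] j = f j.
Proof. by move=> jk; rewrite (bitnE _ (Ordinal jk)) ffunE. Qed.

Lemma lo_join a b M (d : Bits a) (c : Bits b) : M = (a + b)%N ->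
  lo a (join M d c) = d.
Proof.
move=> ->; apply/ffunP => i; rewrite ffunE /join.
rewrite (bitn_ffun (fun i => if (i < a)%N then bitn d i else bitn c (i - a))) ?ltn_addr //.
by rewrite ltn_ord bitnE.
Qed.

Lemma hi_join a b M (d : Bits a) (c : Bits b) : M = (a + b)%N ->
  hi a b (join M d c) = c.
Proof.
move=> ->; apply/ffunP => i; rewrite ffunE /join.
rewrite (bitn_ffun (fun i => if (i < a)%N then bitn d i else bitn c (i - a))) ?ltn_add2l //.
by rewrite ltnNge leq_addr /= addKn bitnE.
Qed.

Lemma join_lo_hi a b M (s : Bits M) : M = (a + b)%N ->
  join M (lo a s) (hi a b s) = s.
Proof.
move=> EM; apply/ffunP => i; rewrite ffunE; case: ltnP => ia.
  by rewrite (bitn_ffun (bitn s)) // bitnE.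
rewrite (bitn_ffun (fun j => bitn s (a + j))) ?subnKC ?bitnE //.
by rewrite ltn_subLR // -EM.
Qed.

Lemma sum_join (K : nmodType) a b M (F : Bits M -> K) : M = (a + b)%N ->
  \sum_s F s = \sum_(c : Bits b) \sum_(d : Bits a) F (join M d c).
Proof.
move=> EM; rewrite pair_big /=.
rewrite (reindex (fun p : Bits b * Bits a => join M p.2 p.1)) //=.
exists (fun s => (hi a b s, lo a s)) => [[c d] _|s _] /=.
  by rewrite lo_join ?hi_join.
exact: join_lo_hi.
Qed.

(** Block-diagonal: the high register holds the control value [c] and is left unchanged, while [W c]
    acts on the low one. *)
Definition ctrl_op (R : realType) a b M (W : Bits b -> Op R a) : Op R M :=
  fun s s' => W (hi a b s) (lo a s) (lo a s') * (hi a b s' == hi a b s)%:R.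

Definition ctrl_vec (R : realType) a b M (f : Vec R b) (g : Bits b -> Vec R a) : Vec R M :=
  fun s => f (hi a b s) * g (hi a b s) (lo a s).

Arguments ctrl_op {R a b} M W _ _.
Arguments ctrl_vec {R a b} M f g _.

Lemma unitary_ctrl (R : realType) a b M (W : Bits b -> Op R a) : M = (a + b)%N ->
  (forall c, unitary (W c)) -> unitary (ctrl_op M W).
Proof.
move=> EM uW x y; rewrite (sum_join _ EM) /ctrl_op.
transitivity (\sum_c (hi a b x == c)%:R * (lo a x == lo a y)%:R
                * (c == hi a b y)%:R : complex R).
  apply: eq_bigr => c _; rewrite -(uW c) mulr_sumr mulr_suml; apply: eq_bigr => d _.
  by rewrite conj_mul_delta lo_join // hi_join // [c == _]eq_sym; ring.
rewrite sum_mul_delta -natrM mulnb; congr (_%:R); congr nat_of_bool.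
apply/andP/eqP => [[/eqP h /eqP l]|->]; last by rewrite !eqxx.
by rewrite -(join_lo_hi x EM) -(join_lo_hi y EM) h l.
Qed.

Lemma apply_ctrl (R : realType) a b M (W : Bits b -> Op R a) f g : M = (a + b)%N ->
  apply (ctrl_op M W) (ctrl_vec M f g) = ctrl_vec M f (fun c => apply (W c) (g c)).
Proof.
move=> EM; apply/funext => s; rewrite {1}/apply (sum_join _ EM) /ctrl_op /ctrl_vec.
transitivity (\sum_c (f c * \sum_d W (hi a b s) (lo a s) d * g c d)
                * (c == hi a b s)%:R).
  apply: eq_bigr => c _; rewrite mulr_sumr mulr_suml; apply: eq_bigr => d _.
  by rewrite lo_join // hi_join //; ring.
exact: sum_mul_delta.
Qed.

(** The oracle reads only qubits [0] to [n], which lie in the low register because [n < a]; hence it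
    acts inside each branch. *)
Lemma phase_ctrl (R : realType) n a b M (U : {set Bits n}) (f : Vec R b)
    (g : Bits b -> Vec R a) :
  M = (a + b)%N -> (n < a)%N ->
  phase_oracle U (ctrl_vec M f g) = ctrl_vec M f (fun c => phase_oracle U (g c)).
Proof.
move=> EM na; apply/funext => s; rewrite /phase_oracle /ctrl_vec.
have E j : (j < a)%N -> bitn (lo a s) j = bitn s j by exact: (bitn_ffun (bitn s)).
have -> : xreg n (lo a s) = xreg n s.
  by apply/ffunP => i; rewrite !ffunE E // (leq_ltn_trans (ltn_ord i)).
rewrite E ?(leq_ltn_trans _ na) //.
by case: ifP => // _; rewrite mulrN.
Qed.

Lemma ket0_ctrl (R : realType) a b M : M = (a + b)%N ->
  ket R [ffun=> false] =
    ctrl_vec M (ket R [ffun=> false]) (fun _ : Bits b => ket R [ffun=> false] : Vec R a).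
Proof.
move=> EM; apply/funext => s; rewrite /ctrl_vec /ket -natrM mulnb.
congr (_%:R); congr nat_of_bool.
have bit0 k j : bitn ([ffun=> false] : Bits k) j = false.
  by rewrite /bitn; case: insubP => // i _ _; rewrite ffunE.
apply/eqP/andP => [->|[/eqP h /eqP l]].
  by split; apply/eqP/ffunP => i; rewrite !ffunE bit0.
by rewrite -(join_lo_hi s EM) h l; apply/ffunP => i; rewrite !ffunE !bit0 if_same.
Qed.

(** A single query of the joint state serves all branches at once, so running them adds [T2] queries
    rather than a sum over [c]. By induction on [T2], the unitaries of the branches are gathered
    into one [ctrl_op]. *)
Lemma reach_ctrl (R : realType) n a b M T1 T2 (f : {set Bits n} -> Vec R b)
    (g : Bits b -> {set Bits n} -> Vec R a) :
  M = (a + b)%N -> (n < a)%N ->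
  reach T1 (fun U => ctrl_vec M (f U) (fun _ : Bits b => ket R [ffun=> false] : Vec R a)) ->
  (forall c, reach T2 (g c)) ->
  reach (T2 + T1) (fun U => ctrl_vec M (f U) (fun c => g c U)).
Proof.
move=> EM na r0; elim: T2 g => [|T2 IH] g rg.
  have [W HW] := choice (fun c => let: ex_intro2 W u e := rg c in ex_intro _ W (conj u e)).
  have -> : (fun U => ctrl_vec M (f U) (fun c => g c U))
     = fun U => apply (ctrl_op M W)
         (ctrl_vec M (f U) (fun _ : Bits b => ket R [ffun=> false] : Vec R a)).
    apply/funext => U; rewrite apply_ctrl //; congr ctrl_vec.
    by apply/funext => c; have [_ ->] := HW c.
  by apply: reach_unitary => //; apply: unitary_ctrl => // c; have [] := HW c.
have [phi /choice[W HW]] := choice rg.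
have -> : (fun U => ctrl_vec M (f U) (fun c => g c U))
   = fun U => apply (ctrl_op M W) (phase_oracle U (ctrl_vec M (f U) (fun c => phi c U))).
  apply/funext => U; rewrite phase_ctrl // apply_ctrl //; congr ctrl_vec.
  by apply/funext => c; have [_ _ ->] := HW c.
apply: reach_query; first by apply: IH => c; have [] := HW c.
by apply: unitary_ctrl => // c; have [] := HW c.
Qed.

(* The oracle acts only on the leading qubits, so [f] is prepared there and then
   swapped behind the fresh register on which the controlled runs [g c] query. *)
Lemma reach_pair (R : realType) n a b T1 T2 (f : {set Bits n} -> Vec R b)
    (g : Bits b -> {set Bits n} -> Vec R a) :
  (n < a)%N -> (n < b)%N -> reach T1 f -> (forall c, reach T2 (g c)) ->
  reach (T2 + T1) (fun U => ctrl_vec (a + b) (f U) (fun c => g c U)).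
Proof.
move=> na nb rf rg; have EM : (a + b = b + a)%N by rewrite addnC.
apply: reach_ctrl => //.
have r1 : reach (T1 + 0) (fun U : {set Bits n} =>
    ctrl_vec (a + b) (ket R [ffun=> false]) (fun _ : Bits a => f U)).
  apply: (@reach_ctrl _ _ _ _ _ _ _ (fun _ => ket R [ffun=> false]) (fun _ => f)) => //.
  by rewrite -ket0_ctrl //; exact: reach_init.
rewrite addn0 in r1.
pose swap (s : Bits (a + b)) : Bits (a + b) := join (a + b) (hi a b s) (lo a s).
have swap_bij : bijective swap.
  exists (fun s => join (a + b) (hi b a s) (lo b s)) => s; rewrite /swap.
    by rewrite lo_join // hi_join // join_lo_hi.
  by rewrite lo_join // hi_join // join_lo_hi.
have -> : (fun U => ctrl_vec (a + b) (f U) (fun _ : Bits b => ket R [ffun=> false] : Vec R a))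
  = fun U => apply (perm_op R swap)
               (ctrl_vec (a + b) (ket R [ffun=> false]) (fun _ : Bits a => f U)).
  apply/funext => U; apply/funext => s.
  by rewrite apply_perm /ctrl_vec /swap lo_join // hi_join // mulrC.
exact: reach_unitary r1 (unitary_perm R swap_bij).
Qed.

(** * Sampling by circuits with a final measurement *)

(** For every [U], [p U] is the outcome distribution of one fixed circuit with [T] queries, read
    through the classical decoding [out]. *)
Definition samples (R : realType) n m T (X : finType) (p : {set Bits n} -> X -> R) : Prop :=
  exists (psi : {set Bits n} -> Vec R m) (out : Bits m -> X),
    reach T psi /\ forall U x, p U x = \sum_(s | out s == x) sqmod (psi U s).

Lemma samples_map (R : realType) n m T (X Y : finType) (p : {set Bits n} -> X -> R)
    (h : X -> Y) :
  samples m T p -> samples m T (fun U y => \sum_(x | h x == y) p U x).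
Proof.
case=> psi [out [rpsi E]]; exists psi, (h \o out); split=> // U y.
rewrite (partition_big out (fun x => h x == y)) //=.
apply: eq_bigr => x hx; rewrite E; apply: eq_bigl => s.
by case: eqP => [->|_]; rewrite ?hx ?andbF.
Qed.

(** Deferred measurement: the second sampler is controlled by the unmeasured register of the first.
    Amplitudes multiply along each branch, hence so do probabilities. *)
Lemma samples_bind (R : realType) n a b T1 T2 (X Y : finType)
    (p : {set Bits n} -> X -> R) (r : X -> {set Bits n} -> Y -> R) :
  (n < a)%N -> (n < b)%N -> samples b T1 p -> (forall x, samples a T2 (r x)) ->
  samples (a + b) (T2 + T1) (fun U xy => p U xy.1 * r xy.1 U xy.2).
Proof.
move=> na nb [f [outf [rf Ef]]] /choice[g /choice[outg Hg]].
exists (fun U => ctrl_vec (a + b) (f U) (fun c => g (outf c) U)),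
  (fun s => (outf (hi a b s), outg (outf (hi a b s)) (lo a s))); split.
  by apply: reach_pair => // c; have [] := Hg (outf c).
move=> U [x y] /=; rewrite [RHS]big_mkcond (@sum_join _ a b) //= Ef mulr_suml big_mkcond.
apply: eq_bigr => c _; case: eqP => [<-|xc].
  have [_ ->] := Hg (outf c); rewrite mulr_sumr big_mkcond; apply: eq_bigr => d _.
  rewrite lo_join // hi_join // xpair_eqE eqxx /= /ctrl_vec lo_join // hi_join //.
  by rewrite sqmodM.
rewrite big1 // => d _; rewrite lo_join // hi_join // xpair_eqE.
by move/eqP/negPf: xc => ->.
Qed.

(** The cardinality of [X] need not be a power of 2, so [x] is encoded one-hot on [#|X|] qubits. The
    [n.+1] leading qubits stay 0 and make the register large enough for the oracle. *)
Lemma samples_uniform (R : realType) n (X : finType) (x0 : X) :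
  samples (n.+1 + #|X|) 0 (fun (_ : {set Bits n}) (_ : X) => #|X|%:R^-1 : R).
Proof.
set m := (n.+1 + #|X|)%N; set N : R := #|X|%:R.
have X0 : (0 < #|X|)%N by apply/card_gt0P; exists x0.
have N0 : 0 < N by rewrite ltr0n.
pose e (x : X) : Bits m := [ffun i : 'I_m => i == rshift n.+1 (enum_rank x)].
have e_inj : injective e.
  move=> x y /ffunP /(_ (rshift n.+1 (enum_rank x))).
  rewrite !ffunE eqxx => /esym /eqP /rshift_inj; exact: enum_rank_inj.
pose z : Bits m := [ffun=> false].
have ez x : e x == z = false.
  by apply/eqP => /ffunP /(_ (rshift n.+1 (enum_rank x))); rewrite !ffunE eqxx.
pose w := Num.sqrt N^-1.
have w2 : w ^+ 2 = N^-1 by rewrite sqr_sqrtr // invr_ge0 ltW.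
(* [reflect_op a] exchanges the zero state and the uniform superposition of the [e x]. *)
pose a (s : Bits m) : R := (s == z)%:R - \sum_x (s == e x)%:R * w.
have az : a z = 1.
  by rewrite /a eqxx big1 ?subr0 // => x _; rewrite eq_sym ez mul0r.
have ae x : a (e x) = - w.
  rewrite /a ez (bigD1 x) //= eqxx big1 => [|y yx]; first by rewrite mul1r addr0 sub0r.
  by rewrite (inj_eq e_inj) eq_sym (negPf yx) mul0r.
have a0 s : s != z -> (forall x, s != e x) -> a s = 0.
  move=> /negPf sz se; rewrite /a sz big1 ?subr0 // => x _.
  by rewrite (negPf (se x)) mul0r.
(* The default [x0] is returned only on basis states of amplitude 0. *)
pose out (s : Bits m) : X := odflt x0 [pick x | s == e x].
have oute x : out (e x) = x.
  by rewrite /out; case: pickP => [y /eqP /e_inj ->|/(_ x)]; rewrite ?eqxx.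
have nz s : s != z -> sqmod (- (a s)%:C)%C = \sum_x (s == e x)%:R * N^-1.
  move=> sz; rewrite sqmodN sqmod_real; case: (pickP (fun x => s == e x)) => [x /eqP ->|no].
    rewrite ae sqrrN w2 (bigD1 x) //= eqxx big1 ?mul1r ?addr0 // => y yx.
    by rewrite (inj_eq e_inj) eq_sym (negPf yx) mul0r.
  rewrite a0 // ?expr0n => [|x]; last by rewrite no.
  by rewrite big1 // => x _; rewrite no mul0r.
have a2 : \sum_s a s ^+ 2 = 2.
  rewrite (bigD1 z) //= az expr1n.
  under eq_bigr => s sz do rewrite -sqmod_real -sqmodN nz //.
  rewrite exchange_big /=.
  under eq_bigr => x _.
    rewrite (bigD1 (e x)) ?ez //= eqxx big1 ?addr0 ?mul1r; last first.
      by move=> s /andP[_ /negPf ->]; rewrite mul0r.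
    over.
  by rewrite sumr_const -[_ *+ _]mulr_natl divff // gt_eqF.
exists (fun _ => apply (reflect_op a) (ket R z)), out; split.
  exact: reach_unitary (reach_init _ _ _) (unitary_reflect a2).
move=> _ x; rewrite apply_ket (bigD1 (e x)) ?oute //= /reflect_op az ez mulr1.
rewrite sub0r nz ?ez // (bigD1 x) //= eqxx mul1r.
rewrite !big1 ?addr0 // => [s /andP[/eqP sx sex]|y yx]; last first.
  by rewrite (inj_eq e_inj) eq_sym (negPf yx) mul0r.
case: (eqVneq s z) => [->|sz].
  by rewrite az mulr1 /= !subrr expr0n addr0.
rewrite mulr1 sub0r nz // big1 // => y _; case: eqP => [sy|_]; last by rewrite mul0r.
by case/eqP: sex; rewrite sy -sx sy oute.
Qed.

(** * One round: simulating the run with a known set *)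

(** The set [D] is fixed, so its oracle is a diagonal unitary independent of [U] and costs no query.
    An index past the end gives the default [d U], which costs none either. *)
Lemma reach_S_query_states (R : realType) n m (D : {set Bits n})
    (st : seq (oracle_tag * Op R m)) T0 t (psi d : {set Bits n} -> Vec R m) j :
  (forall o W, List.In (o, W) st -> unitary W) -> reach 0 d -> reach T0 psi ->
  (T0 + count (fun p => isOU p.1) st <= t)%N ->
  exists2 T, (T <= t)%N &
    reach T (fun U => nth (d U) (S_query_states D U st (psi U)) j).
Proof.
move=> uW rd; elim: st T0 psi j uW => [|[o W] st IH] T0 psi j uW rpsi.
  by move=> _; exists 0%N => //; case: j.
have uW1 : unitary W by apply: uW; left.
have uW' o' W' : List.In (o', W') st -> unitary W'.
  by move=> h; apply: uW; right; exact: h.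
case: o {uW} => /= le_t; last first.
  by apply: (IH T0.+1) uW' _ _; [exact: reach_query | rewrite addSn -addnS].
rewrite add0n in le_t.
case: j => [|j] /=; first by exists T0 => //; apply: leq_trans le_t; exact: leq_addr.
apply: (IH T0) uW' _ le_t; apply: (reach_unitary (psi := fun U => phase_oracle D (psi U))) => //.
pose sgn (s : Bits m) : complex R := if bitn s 0 && (xreg n s \in D) then -1 else 1.
have -> : (fun U => phase_oracle D (psi U)) = fun U => apply (diag_op sgn) (psi U).
  apply/funext => U; rewrite apply_diag; apply/funext => s.
  by rewrite /phase_oracle /sgn; case: ifP => _; rewrite ?mulN1r ?mul1r.
apply: reach_unitary => //; apply: unitary_diag => s.
by rewrite /sgn; case: ifP => _; rewrite ?sqmodN; exact: (sqmod_delta R true).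
Qed.

(** For a fixed [w], the transposition of the zero string and the encoded witness prepares the start
    state. *)
Lemma reach_init_state (R : realType) n q m (w : Bits q) :
  reach 0 (fun _ : {set Bits n} => @init_state R q m w).
Proof.
set e : Bits m := [ffun i : 'I_m => bitn w i].
have -> : @init_state R q m w = apply (perm_op R (tperm [ffun=> false] e)) (ket R [ffun=> false]).
  rewrite apply_perm; apply/funext => s; rewrite /init_state /ket -/e.
  by congr (_%:R); congr nat_of_bool; rewrite (can2_eq (tpermK _ _) (tpermK _ _)) tpermL.
apply: reach_unitary (reach_init _ _ _) (unitary_perm _ _).
by exists (tperm [ffun=> false] e); exact: tpermK.
Qed.

(** Probability that a round outputs [x]. The index [j] ranges over [t] values even when there are
    fewer queries to [S]; surplus indices measure the state after [qa_init]. *)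
Definition round_prob (R : realType) n q t (A : qalg R) (w : Bits q)
    (D U : {set Bits n}) (x : Bits n) : R :=
  t%:R^-1 * \sum_(j < t) hit [set x] (nth (apply (@qa_init R A) (@init_state R q (qa_m A) w))
    (S_query_states D U (qa_steps A) (apply (@qa_init R A) (@init_state R q (qa_m A) w))) j).

Lemma samples_round (R : realType) n q t (A : qalg R) (w : Bits q) (D : {set Bits n}) :
  (0 < t)%N -> (n < qa_m A)%N -> qa_unitary A -> (nqueries_U A <= t)%N ->
  samples (qa_m A + (n.+1 + t)) t (round_prob t A w D).
Proof.
move=> t0 nm [uI uW] le_t.
pose d (_ : {set Bits n}) := apply (@qa_init R A) (@init_state R q (qa_m A) w).
pose psi (j : 'I_t) U := nth (d U) (S_query_states D U (qa_steps A) (d U)) j.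
have rd : reach 0 d by apply: reach_unitary uI; exact: reach_init_state.
have step j : samples (qa_m A) t (fun U (x : Bits n) => hit [set x] (psi j U)).
  have [T leT rT] := reach_S_query_states D j uW rd rd le_t.
  (* Branches of a controlled run must use equally many queries, so each is padded to [t]. *)
  have [phi rphi E] := reach_pad leT rT.
  exists phi, (@xreg n (qa_m A)); split=> // U x.
  by rewrite /hit; apply: eq_big => [s|s _]; rewrite ?inE // E.
have unif := samples_uniform R n (Ordinal t0); rewrite card_ord in unif.
(* The random index [j] is forgotten, which sums the joint distribution over [j]. *)
have /(samples_map snd) [phi [out [rphi E]]] :=
  samples_bind nm (leq_addr t n.+1) unif step.
exists phi, out; split; first by rewrite -[X in reach X]addn0.
move=> U x; rewrite -E /round_prob mulr_sumr.
rewrite -(pair_big predT (fun y => y == x) (fun j y => t%:R^-1 * hit [set y] (psi j U))) /=.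
by apply: eq_bigr => j _; rewrite big_pred1_eq.
Qed.

(** * Success probability of one round *)

Lemma sum_hit (R : realType) n m (E : {set Bits n}) (v : Vec R m) :
  \sum_(x in E) hit [set x] v = hit E v.
Proof.
rewrite /hit [RHS](partition_big (@xreg n m) (mem E)) //=.
apply: eq_bigr => x xE; apply: eq_bigl => s; rewrite inE.
by case: eqP => [->|_]; rewrite ?xE ?andbF.
Qed.

Lemma ler_sum_nth (R : realType) (T : Type) (d : T) (s : seq T) t (f : T -> R) :
  (forall x, 0 <= f x) -> (size s <= t)%N ->
  \sum_(x <- s) f x <= \sum_(j < t) f (nth d s j).
Proof.
move=> f0 st; rewrite -(big_mkord predT (fun j => f (nth d s j))) (big_nth d).
by rewrite (big_cat_nat (leq0n _) st) //= lerDl; apply: sumr_ge0.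
Qed.

Lemma round_prob_ge (R : realType) n q t (A : qalg R) (w : Bits q) (D S U : {set Bits n}) :
  (0 < t)%N -> qa_unitary A -> (nqueries_S A <= t)%N -> D \subset S ->
  2%:R / 3%:R <= acc_prob A S U w -> acc_prob A D U w <= 1 / 3%:R ->
  1 / (36%:R * t%:R ^+ 2) <= \sum_(x in S :\: D) round_prob t A w D U x.
Proof.
move=> t0 [uI uW] le_t DS accS accD.
set v0 := apply (@qa_init R A) (@init_state R q (qa_m A) w).
set vs := S_query_states D U (qa_steps A) v0.
pose a (j : 'I_t) := Num.sqrt (hit (S :\: D) (nth v0 vs j)).
have -> : \sum_(x in S :\: D) round_prob t A w D U x
    = t%:R^-1 * \sum_(j < t) a j ^+ 2.
  rewrite /round_prob -mulr_sumr exchange_big /=; congr (_ * _).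
  by apply: eq_bigr => j _; rewrite sum_hit sqr_sqrtr ?hit_ge0.
have norm1 E : vnorm2 (steps_run E U (qa_steps A) v0) = 1.
  by rewrite vnorm2_steps_run // vnorm2_apply // vnorm2_ket.
(* The acceptance gap [2 / 3 - 1 / 3], halved by the factor 2 in [hybrid_bound]; both runs start
   from [v0], so the initial distance is 0. *)
have sum_a : 1 / 6 <= \sum_j a j.
  have gap := event_prob_diff (fun s => bitn s 0) (norm1 S) (norm1 D).
  rewrite -[X in X - _ <= _]/(acc_prob A S U w) -[X in _ - X <= _]/(acc_prob A D U w) in gap.
  have := hybrid_bound U v0 v0 DS uW.
  have -> : vnorm (fun s => v0 s - v0 s) = 0.
    rewrite /vnorm /vnorm2 big1 ?sqrtr0 // => s _; rewrite subrr; exact: sqmod0.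
  rewrite -mulr_sumr -/vs.
  have := ler_sum_nth v0 (fun x => sqrtr_ge0 (hit (S :\: D) x))
    (leq_trans (eq_leq (size_S_query_states D U (qa_steps A) v0)) le_t).
  rewrite -/vs -/(\sum_j a j); lra.
(* Comparison with the constant 1 costs a factor [t]; the average over [j] costs another one. *)
have := cauchy_schwarz a (fun=> 1).
under eq_bigr do rewrite mulr1.
rewrite [X in _ <= _ * X](eq_bigr (fun=> 1)) => [|j _]; last by rewrite expr1n.
rewrite sumr_const card_ord => cs.
have tR : 0 < t%:R :> R by rewrite ltr0n.
have cs' : (1 / 6) ^+ 2 <= (\sum_j a j ^+ 2) * t%:R.
  by apply: le_trans cs; rewrite lerXn2r ?nnegrE //; lra.
rewrite ler_pdivrMr; last by rewrite mulr_gt0 ?exprn_gt0.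
have -> : t%:R^-1 * (\sum_j a j ^+ 2) * (36%:R * t%:R ^+ 2) = 36%:R * ((\sum_j a j ^+ 2) * t%:R).
  by field; rewrite gt_eqF.
by lra.
Qed.

(** * Iterating the rounds *)

Lemma samples_ge0 (R : realType) n m T (X : finType) (p : {set Bits n} -> X -> R) U x :
  samples m T p -> 0 <= p U x.
Proof. by case=> psi [out [_ ->]]; apply: sumr_ge0 => s _; exact: sqmod_ge0. Qed.

Definition distinct_in n i (S : {set Bits n}) (xs : i.-tuple (Bits n)) : bool :=
  uniq xs && all (fun x => x \in S) xs.

(** The guessed witness is kept in the outcome, so all rounds share it and the bound is proved for
    each [w] separately; [2 ^ q] comes from the uniform guess. Sets with fewer than [i] elements
    suffice, since every round starts from those found in the earlier ones. *)
Lemma cumulative_sampler (R : realType) n q t M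
    (r : Bits q -> {set Bits n} -> {set Bits n} -> Bits n -> R) (delta : R) i :
  (n < M)%N -> 0 <= delta -> (forall w D, samples M t (r w D)) ->
  exists m (p : {set Bits n} -> Bits q * i.-tuple (Bits n) -> R),
    [/\ (n < m)%N, samples m (i * t) p &
      forall (S U : {set Bits n}) (w : Bits q),
        (forall D : {set Bits n}, D \subset S -> (#|D| < i)%N ->
           delta <= \sum_(x in S :\: D) r w D U x) ->
        (2%:R ^+ q)^-1 * delta ^+ i <= \sum_(xs | distinct_in S xs) p U (w, xs)].
Proof.
move=> nM delta0 sr; elim: i => [|i [m [p [nm sp Hp]]]].
  have unif := samples_uniform R n ([ffun=> false] : Bits q).
  have cardB : #|{: Bits q}| = (2 ^ q)%N by rewrite card_ffun card_bool card_ord.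
  exists (n.+1 + #|{: Bits q}|)%N; eexists; split; [exact: leq_addr | |].
    exact: (samples_map (fun w => (w, [tuple] : 0.-tuple (Bits n))) unif).
  move=> S U w _; rewrite (big_pred1 [tuple]) => [|xs]; last by rewrite (tuple0 xs); exact/esym/eqP.
  rewrite (big_pred1 w) => [|w' /=]; last first.
    by rewrite -pair_eqE /= (_ : _ == _ :> 0.-tuple _ = true) ?andbT //; exact: eqxx.
  by rewrite expr0 mulr1 cardB natrX.
pose h (z : Bits q * i.-tuple (Bits n) * Bits n) := (z.1.1, [tuple of z.2 :: z.1.2]).
(* The new round is run with [D] equal to the set of elements output so far. *)
have sb := samples_bind nM nm sp (fun wx => sr wx.1 [set x in wx.2]).
exists (M + m)%N; eexists; split; [exact: ltn_addl | exact: (samples_map h sb) |].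
move=> S U w Hr; set F := fun z => p U z.1 * r z.1.1 [set x in z.1.2] U z.2.
rewrite -[leRHS]/(\sum_(xs | distinct_in S xs) \sum_(z | h z == (w, xs)) F z).
(* Success of [i.+1] rounds means success of the first [i] and then a new [y] in [S]: distinctness
   of [y :: xs] amounts to that of [xs] and [y] outside its set. *)
have -> : \sum_(xs | distinct_in S xs) \sum_(z | h z == (w, xs)) F z
    = \sum_(xs | distinct_in S xs) \sum_(y in S :\: [set x in xs]) F ((w, xs), y).
  transitivity (\sum_(z | (z.1.1 == w) && distinct_in S (h z).2) F z).
    rewrite [RHS](partition_big (fun z => (h z).2) (fun xs => distinct_in S xs)) /=; last first.
      by move=> z /andP[].
    apply: eq_bigr => xs gxs; apply: eq_bigl => z; rewrite {1}/h xpair_eqE -andbA.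
    by congr (_ && _); rewrite /=; case: eqP => [->|_]; rewrite ?gxs ?andbF.
  rewrite pair_big_dep /= (reindex (fun z : i.-tuple (Bits n) * Bits n => ((w, z.1), z.2))) /=.
    apply: eq_bigl => -[xs y] /=; rewrite eqxx !inE /distinct_in /=.
    by case: (y \in xs); case: (y \in S); case: (uniq xs); case: (all _ xs).
  by exists (fun z => (z.1.2, z.2)) => [[xs y] //|[[w' xs] y]]; rewrite inE /= => /andP[/eqP -> _].
have IH := Hp S U w (fun D DS Di => Hr D DS (ltnW Di)).
rewrite exprSr mulrA; apply: le_trans (ler_wpM2r delta0 IH) _.
rewrite mulr_suml; apply: ler_sum => xs /andP[uxs /allP sxs].
rewrite /F /= -mulr_sumr; apply: ler_wpM2l; first exact: samples_ge0 sp.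
apply: Hr; first by apply/fintype.subsetP => x; rewrite inE => /sxs.
by rewrite ltnS cardsE; apply: leq_trans (card_size _) _; rewrite size_tuple.
Qed.

(** * Assembling the sampler *)

Theorem mainTheorem2 (R : realType) (n q t : nat)
  (hn : (0 < n)%N) (hq : (0 < q)%N) (ht : (0 < t)%N)
  (A : qalg R)
  (hAu : qa_unitary A) (hAn : (n < qa_m A)%N) (hAq : (q <= qa_m A)%N)
  (hAS : (nqueries_S A <= t)%N) (hAU : (nqueries_U A <= t)%N)
  (hyes : forall S U : {set Bits n}, 59%:R / 100%:R <= spec_forr R S U ->
            exists w : Bits q, 2%:R / 3%:R <= acc_prob A S U w)
  (hno : forall S U : {set Bits n}, spec_forr R S U <= 57%:R / 100%:R ->
            forall w : Bits q, acc_prob A S U w <= 1 / 3%:R)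
  (v : nat) :
  exists (B : qalg R) (out : Bits (qa_m B) -> v.-tuple (Bits n)),
    [/\ qa_unitary B, (n < qa_m B)%N, nqueries_S B = 0%N,
        nqueries_U B = (v * t)%N &
    forall S U : {set Bits n},
      59%:R / 100%:R <= spec_forr R S U ->
      (forall Delta : {set Bits n}, Delta \subset S -> (#|Delta| <= v)%N ->
         spec_forr R Delta U <= 57%:R / 100%:R) ->
      (2%:R ^+ q)^-1 * (1 / (36%:R * t%:R ^+ 2)) ^+ v <= sample_prob out S U].
Proof.
have delta0 : 0 <= 1 / (36%:R * t%:R ^+ 2) :> R.
  by rewrite divr_ge0 ?mulr_ge0 ?exprn_ge0.
have nM : (n < qa_m A + (n.+1 + t))%N by rewrite ltn_addr.
have sr (w : Bits q) (D : {set Bits n}) := samples_round w D ht hAn hAu hAU.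
have [m [p [nm [psi [out [rpsi Ep]]] Hp]]] := cumulative_sampler v nM delta0 sr.
have [W0 [Ws [uW0 uWs sW run_psi]]] := reach_qalg rpsi.
exists (QAlg W0 [seq (OU, W) | W <- Ws]), (fun s => (out s).2); split=> //.
- split=> //= o W; elim: Ws uWs {sW run_psi} => //= V Ws IH uWs [[_ <-]|h].
    by apply: uWs; left.
  by apply: IH h => W' h'; apply: uWs; right.
- by rewrite /nqueries_S count_map /= count_pred0.
- by rewrite /nqueries_U count_map /= count_predT.
(* The good witness enters only the analysis; the circuit is already fixed. *)
move=> S U yes no; have [w accS] := hyes _ _ yes.
have Hr (D : {set Bits n}) : D \subset S -> (#|D| < v)%N ->
    1 / (36%:R * t%:R ^+ 2) <= \sum_(x in S :\: D) round_prob t A w D U x.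
  move=> DS Dv; apply: round_prob_ge => //; apply/hno/no => //; exact: ltnW.
apply: le_trans (Hp S U w Hr) _.
rewrite /sample_prob -[run _ _ _]/(steps_run S U _ _) run_psi.
under eq_bigr do rewrite Ep.
have -> : \sum_(xs | distinct_in S xs) \sum_(s | out s == (w, xs)) sqmod (psi U s)
    = \sum_(s | ((out s).1 == w) && distinct_in S (out s).2) sqmod (psi U s).
  rewrite [RHS](partition_big (fun s => (out s).2) (fun xs => distinct_in S xs)) /=; last first.
    by move=> s /andP[].
  apply: eq_bigr => xs gxs; apply: eq_bigl => s; rewrite -andbA.
  case: (out s) => w' xs' /=; rewrite xpair_eqE.
  by congr (_ && _); case: eqP => [->|_]; rewrite ?gxs ?andbF.
(* Runs that guessed [w] are among all successful runs, and the other terms are nonnegative. *)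
rewrite [leRHS]big_mkcond [leLHS]big_mkcond; apply: ler_sum => s _.
rewrite /distinct_in; case: eqP => _ //=; case: ifP => _ //; exact: sqmod_ge0.
Qed.
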